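(* Let $(Q,+,\cdot,\le)$ be an arbitrary ordered field and $n\ge 2$. (1) Neither $\sigma$ nor $\lambda$ can be defined in $(Q^n,\tau)$ by an existential formula with 2 quantifiers or by a universal formula with 2 quantifiers (i.e., existentially or universally using only 4 variables). (2) Neither $\tau$ nor $\lambda$ can be defined in $(Q^n,\sigma)$ by an existential formula with 2 quantifiers or by a universal formula with 2 quantifiers.
   Context: For $p=(p_0,\dots,p_{n-1}),\,q=(q_0,\dots,q_{n-1})\in Q^n$: $p\,\tau\,q$ iff $(p_0-q_0)^2>\sum_{i=1}^{n-1}(p_i-q_i)^2$; $p\,\lambda\,q$ iff $(p_0-q_0)^2=\sum_{i=1}^{n-1}(p_i-q_i)^2$ and $p_0\neq q_0$; $p\,\sigma\,q$ iff $(p_0-q_0)^2<\sum_{i=1}^{n-1}(p_i-q_i)^2$. An existential (universal) formula with 2 quantifiers defining a binary relation is one of the form $\exists z_1\exists z_2\,\psi(p,q,z_1,z_2)$ (resp. $\forall z_1\forall z_2\,\psi$) with $\psi$ quantifier-free in the language with equality and one binary relation symbol interpreted as the given relation; definitions are without parameters. *)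

(* Defs.v *)
From HB Require Import structures.
From mathcomp Require Import all_boot all_order all_algebra.

Set Implicit Arguments.
Unset Strict Implicit.
Unset Printing Implicit Defensive.

Import Order.TTheory GRing.Theory Num.Theory.
Local Open Scope ring_scope.

(* A point of Q^(d+1) has coordinates p 0 0 (time) and p 0 i, i != 0 (the d
   space coordinates). *)
Section Relations.
Variables (Q : realFieldType) (d : nat).
Implicit Types p q : 'rV[Q]_d.+1.

Definition time_sq p q : Q := (p 0 0 - q 0 0) ^+ 2.

Definition space_sq p q : Q := \sum_(i < d.+1 | i != 0) (p 0 i - q 0 i) ^+ 2.

Definition timelike : rel 'rV[Q]_d.+1 :=
  fun p q => space_sq p q < time_sq p q.

Definition lightlike : rel 'rV[Q]_d.+1 :=
  fun p q => (time_sq p q == space_sq p q) && (p 0 0 != q 0 0).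

Definition spacelike : rel 'rV[Q]_d.+1 :=
  fun p q => time_sq p q < space_sq p q.

End Relations.

(* Quantifier-free formulas, with variables in V, of the first-order language
   with equality and one binary relation symbol. *)
Inductive qf_formula (V : Type) : Type :=
| QFeq of V & V
| QFrel of V & V
| QFnot of qf_formula V
| QFand of qf_formula V & qf_formula V
| QFor of qf_formula V & qf_formula V.

Fixpoint qf_holds (V : Type) (T : eqType) (S : rel T) (v : V -> T)
    (f : qf_formula V) : bool :=
  match f with
  | QFeq x y => v x == v y
  | QFrel x y => S (v x) (v y)
  | QFnot g => ~~ qf_holds S v g
  | QFand g h => qf_holds S v g && qf_holds S v h
  | QFor g h => qf_holds S v g || qf_holds S v h
  end.

(* psi(p, q, z1, z2): the four variables 0, 1, 2, 3 denote p, q, z1, z2. *)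
Definition qf_holds4 (T : eqType) (S : rel T) (psi : qf_formula 'I_4)
    (p q z1 z2 : T) : bool :=
  qf_holds S (tnth [tuple p; q; z1; z2]) psi.

Definition ex2_definable (T : eqType) (S D : rel T) : Prop :=
  exists psi : qf_formula 'I_4, forall p q : T,
    D p q <-> exists z1 z2 : T, qf_holds4 S psi p q z1 z2.

Definition all2_definable (T : eqType) (S D : rel T) : Prop :=
  exists psi : qf_formula 'I_4, forall p q : T,
    D p q <-> forall z1 z2 : T, qf_holds4 S psi p q z1 z2.

(* Main.v *)
Require Import Defs.
From mathcomp Require Import all_boot all_order all_algebra.
From mathcomp Require Import ring lra.

Set Implicit Arguments.
Unset Strict Implicit.
Unset Printing Implicit Defensive.

Import Order.TTheory GRing.Theory Num.Theory.
Local Open Scope ring_scope.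

(**
Work in [(Q^n, tau)].  Existential formulas only see the isomorphism types of
the substructures {p, q, z1, z2}, so it suffices to turn every such
substructure with p lambda q into an isomorphic one with p sigma q, and
conversely.  Contracting the time axis by a factor slightly below 1 preserves
tau and its negation on finitely many points but turns lambda into sigma.
Conversely, every graph on four vertices p, q, z1, z2 in which p and q are not
adjacent embeds in the plane of null coordinates (u, v), where tau is
comparability in the strict product order, with p and q at the same height
v, i.e. with p lambda q: this is a finite check.  For [(Q^n, sigma)] exchange
the roles of time and space.
*)

(** * Undefinability by transfer of quantifier-free types *)

Definition same_qf_type (V : Type) (T : eqType) (S : rel T) (v w : V -> T) :=
  forall i j, (v i == v j) = (w i == w j) /\ S (v i) (v j) = S (w i) (w j).

Lemma qf_holds_same_type (V : Type) (T : eqType) (S : rel T) (v w : V -> T) f :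
  same_qf_type S v w -> qf_holds S v f = qf_holds S w f.
Proof.
move=> vw; elim: f => //= [x y|x y|f ->|f -> g ->|f -> g ->] //.
- by case: (vw x y).
- by case: (vw x y).
Qed.

Definition o0 : 'I_4 := Ordinal (isT : 0 < 4)%N.
Definition o1 : 'I_4 := Ordinal (isT : 1 < 4)%N.
Definition o2 : 'I_4 := Ordinal (isT : 2 < 4)%N.
Definition o3 : 'I_4 := Ordinal (isT : 3 < 4)%N.

Lemma ord4_ind (P : 'I_4 -> Prop) : P o0 -> P o1 -> P o2 -> P o3 ->
  forall i, P i.
Proof.
move=> P0 P1 P2 P3 [[|[|[|[|//]]]] lti].
- by rewrite (_ : Ordinal _ = o0) //; apply: val_inj.
- by rewrite (_ : Ordinal _ = o1) //; apply: val_inj.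
- by rewrite (_ : Ordinal _ = o2) //; apply: val_inj.
- by rewrite (_ : Ordinal _ = o3) //; apply: val_inj.
Qed.

Definition transfers (T : eqType) (S A B : rel T) :=
  forall v : 'I_4 -> T, A (v o0) (v o1) ->
  exists2 w, B (w o0) (w o1) & same_qf_type S v w.

(** One transfer refutes two definitions. Witnesses for an [A]-pair move to a [B]-pair, which an
    existential definition of [A] would then accept. A universal definition of [B] holds on all
    [B]-pairs, so pulling its matrix back along the transfer makes it accept the [A]-pair [p],
    [q]. *)
Lemma transfers_undefinable (T : eqType) (S A B : rel T) (p q : T) :
  (forall x y, B x y -> ~~ A x y) -> transfers S A B -> A p q ->
  ~ ex2_definable S A /\ ~ all2_definable S B.
Proof.
move=> BnA trAB Apq.
have move_witness z1 z2 : exists2 w : 'I_4 -> T, B (w o0) (w o1) & forall psi,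
    qf_holds4 S psi p q z1 z2 = qf_holds4 S psi (w o0) (w o1) (w o2) (w o3).
  have [w Bw vw] := trAB (tnth [tuple p; q; z1; z2]) Apq.
  exists w => // psi; apply: qf_holds_same_type => i j; have [-> ->] := vw i j.
  suff E : tnth [tuple w o0; w o1; w o2; w o3] =1 w by rewrite !E.
  by apply: ord4_ind.
split=> -[psi defpsi].
- have [z1 [z2 psiz]] := (defpsi p q).1 Apq.
  have [w /BnA/negP nAw psiw] := move_witness z1 z2.
  by apply/nAw/defpsi; exists (w o2), (w o3); rewrite -psiw.
- have /negP[] : ~~ B p q by apply/negP => /BnA; rewrite Apq.
  apply/defpsi => z1 z2; have [w Bw ->] := move_witness z1 z2.
  exact: (defpsi _ _).1.
Qed.

(** * Graphs on four vertices in a planar grid *)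

Definition comparable2 (x y : nat * nat) : bool :=
  ((x.1 < y.1) && (x.2 < y.2) || (y.1 < x.1) && (y.2 < x.2))%N.

Lemma comparable2C : symmetric comparable2.
Proof. by move=> x y; rewrite /comparable2 orbC. Qed.

(* The smallest square grid in which the search below succeeds. *)
Definition grid := [seq (i, j) | i <- iota 0 5, j <- iota 0 5].

(** The points [(1, 2)] and [(3, 2)] stand for p and q: they share a height, and leave free columns
    to the left, between and to the right, and free rows above and below. The 32 cases are settled
    by computation. *)
Lemma graph4_search (e02 e03 e12 e13 e23 : bool) :
  has (fun a => has (fun b =>
    [&& uniq [:: (1, 2); (3, 2); a; b],
        e02 == comparable2 (1, 2) a, e03 == comparable2 (1, 2) b,
        e12 == comparable2 (3, 2) a, e13 == comparable2 (3, 2) b &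
        e23 == comparable2 a b]) grid) grid.
Proof. by move: e02 e03 e12 e13 e23 => [] [] [] [] []; vm_compute. Qed.

Lemma graph4_realizable (e : rel 'I_4) :
  symmetric e -> irreflexive e -> ~~ e o0 o1 ->
  exists u : 'I_4 -> nat * nat,
    [/\ injective u, (u o0).1 != (u o1).1, (u o0).2 = (u o1).2
      & forall i j, e i j = comparable2 (u i) (u j)].
Proof.
move=> e_sym e_irr /negbTE e01.
have /hasP[a _ /hasP[b _]] :=
  graph4_search (e o0 o2) (e o0 o3) (e o1 o2) (e o1 o3) (e o2 o3).
case/and5P=> u_uniq /eqP e02 /eqP e03 /eqP e12 /andP[/eqP e13 /eqP e23].
pose t := [tuple (1, 2)%N; (3, 2)%N; a; b].
have u_inj : injective (tnth t) by apply/tuple_uniqP.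
have e_irr' x : comparable2 x x = false by rewrite /comparable2 !ltnn.
exists (tnth t); split => //; elim/ord4_ind; elim/ord4_ind;
  rewrite ?e_irr ?e_irr' // 1?e_sym ?e01 ?e02 ?e03 ?e12 ?e13 ?e23 //
    1?comparable2C // e_sym.
all: by rewrite ?e01 ?e02 ?e03 ?e12 ?e13 ?e23.
Qed.

(** The embedding [f] is kept abstract to serve both [timelike] and [spacelike]. The condition on
    [A] makes the first two vertices distinct and non-adjacent, as the grid realization requires. *)
Lemma transfers_plane (T : eqType) (S A B : rel T) (f : nat * nat -> T) :
    symmetric S -> irreflexive S ->
    (forall x y, A x y -> (x != y) && ~~ S x y) ->
    injective f -> {mono f : x y / comparable2 x y >-> S x y} ->
    (forall x y, x.1 != y.1 -> x.2 = y.2 -> B (f x) (f y)) ->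
  transfers S A B.
Proof.
move=> S_sym S_irr AnS f_inj fS fB v /AnS/andP[v01 nSv01].
have [||//|u [u_inj u1 u2 eu]] := @graph4_realizable (relpre v S).
- by move=> i j; apply: S_sym.
- by move=> i; apply: S_irr.
(* [u] separates all four indices: points that [v] identifies are first sent
   to a common index. *)
pose rep x := if x == v o0 then o0 else if x == v o1 then o1 else
              if x == v o2 then o2 else o3.
have repK i : v (rep (v i)) = v i.
  rewrite /rep; do 3![case: eqP => [-> //|]].
  by elim/ord4_ind: i.
have rep0 : rep (v o0) = o0 by rewrite /rep eqxx.
have rep1 : rep (v o1) = o1 by rewrite /rep eq_sym (negbTE v01) eqxx.
exists (fun i => f (u (rep (v i)))); first by rewrite rep0 rep1; apply: fB.
move=> i j; split; last by rewrite fS -eu /= !repK.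
rewrite (inj_eq f_inj) (inj_eq u_inj); apply/eqP/eqP => [->//|].
by move/(congr1 v); rewrite !repK.
Qed.

(** * Contractions of time or of space *)

Section Minkowski.
Variables (Q : realFieldType).

(** Each strict inequality survives for all factors close enough to 1, so the largest of finitely
    many suitable factors serves for all. *)
Lemma same_strict_after_shrinking (s : seq (Q * Q)) :
  {in s, forall x, 0 <= x.1} ->
  exists2 c : Q, 0 < c < 1 & {in s, forall x, x.1 < x.2 -> x.1 < c ^+ 2 * x.2}.
Proof.
elim: s => [_|[a b] s IHs s_ge0]; first by exists 2^-1; first lra.
have [x sx|c c01 sc] := IHs; first by apply: s_ge0; rewrite inE sx orbT.
have a_ge0 : 0 <= a by have /= := s_ge0 (a, b); rewrite inE eqxx; apply.
have [lt_ab|] := ltP a b; last first.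
  move=> le_ba; exists c => // x.
  rewrite inE => /predU1P[->/=|]; last exact: sc.
  by rewrite ltNge le_ba.
have b_gt0 : 0 < b by apply: le_lt_trans lt_ab.
(* A square root of [a / b] may not exist in [Q]. With [r = a / b], the mean of 1 and [r] works
   instead, since [d ^+ 2 - r = ((1 - r) / 2) ^+ 2 > 0]. *)
pose d := (1 + a / b) / 2.
have r_ge0 : 0 <= a / b by rewrite divr_ge0 // ltW.
have r_lt1 : a / b < 1 by rewrite ltr_pdivrMr // mul1r.
have d_good : a < d ^+ 2 * b by rewrite -ltr_pdivrMr // /d; nra.
have d01 : 0 < d < 1 by rewrite /d; lra.
have [cd|dc] := leP c d; [exists d|exists c] => // x;
  rewrite inE => /predU1P[->//= _|sx lt_x].
- apply: lt_le_trans (sc x sx lt_x) _; apply: ler_wpM2r.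
    by apply/ltW/(le_lt_trans _ lt_x)/s_ge0; rewrite inE sx orbT.
  by nra.
- by apply: (lt_le_trans d_good); apply: ler_wpM2r; [lra|nra].
- exact: sc.
Qed.

Section Dimension.
Variable d : nat.
Implicit Types p q : 'rV[Q]_d.+1.

Lemma time_sq_ge0 p q : 0 <= time_sq p q.
Proof. exact: sqr_ge0. Qed.

Lemma space_sq_ge0 p q : 0 <= space_sq p q.
Proof. by apply: sumr_ge0 => i _; apply: sqr_ge0. Qed.

Lemma time_sqC p q : time_sq p q = time_sq q p.
Proof. by rewrite /time_sq -sqrrN opprB. Qed.

Lemma space_sqC p q : space_sq p q = space_sq q p.
Proof. by apply: eq_bigr => i _; rewrite -sqrrN opprB. Qed.

Lemma timelikeC : symmetric (@timelike Q d).
Proof. by move=> p q; rewrite /timelike time_sqC space_sqC. Qed.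

Lemma spacelikeC : symmetric (@spacelike Q d).
Proof. by move=> p q; rewrite /spacelike time_sqC space_sqC. Qed.

Lemma time_sqxx p : time_sq p p = 0.
Proof. by rewrite /time_sq subrr expr0n. Qed.

Lemma space_sqxx p : space_sq p p = 0.
Proof. by apply: big1 => i _; rewrite subrr expr0n. Qed.

Definition rescale (a b : Q) p : 'rV[Q]_d.+1 :=
  \row_i ((if i == 0 then a else b) * p 0 i).

Lemma rescale_inj a b : a != 0 -> b != 0 -> injective (rescale a b).
Proof.
move=> a0 b0 p q /rowP pq; apply/rowP => i; have := pq i; rewrite !mxE.
by apply: mulfI; case: ifP.
Qed.

Lemma time_sq_rescale a b p q :
  time_sq (rescale a b p) (rescale a b q) = a ^+ 2 * time_sq p q.
Proof. by rewrite /time_sq !mxE eqxx -mulrBr exprMn. Qed.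

Lemma space_sq_rescale a b p q :
  space_sq (rescale a b p) (rescale a b q) = b ^+ 2 * space_sq p q.
Proof.
rewrite /space_sq mulr_sumr; apply: eq_bigr => i /negbTE i0.
by rewrite !mxE i0 -mulrBr exprMn.
Qed.

Lemma lightlike_sq_gt0 p q :
  lightlike p q -> time_sq p q = space_sq p q /\ 0 < time_sq p q.
Proof.
case/andP=> /eqP <-; rewrite -subr_eq0 => pq0; split=> //.
by rewrite lt_def sqr_ge0 sqrf_eq0 pq0.
Qed.

Lemma transfers_lightlike_spacelike :
  transfers (@timelike Q d) (@lightlike Q d) (@spacelike Q d).
Proof.
move=> v /lightlike_sq_gt0[eq01 gt01].
have [|c c01 shrink] := @same_strict_after_shrinking
    [seq (space_sq (v i) (v j), time_sq (v i) (v j)) |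
       i <- enum 'I_4, j <- enum 'I_4].
  by move=> _ /allpairsP[ij [_ _ ->]]; apply: space_sq_ge0.
have c2_lt1 : c ^+ 2 < 1 by nra.
have resc_inj : injective (rescale c 1 : 'rV[Q]_d.+1 -> _).
  by apply: rescale_inj; rewrite ?oner_neq0 // gt_eqF //; lra.
exists (fun i => rescale c 1 (v i)).
  rewrite /spacelike time_sq_rescale space_sq_rescale -eq01.
  by rewrite expr1n mul1r gtr_pMl.
move=> i j; split; first by rewrite (inj_eq resc_inj).
rewrite /timelike time_sq_rescale space_sq_rescale expr1n mul1r.
(* Contracting time never creates a timelike pair, and the choice of [c] destroys none. *)
apply/idP/idP => [|lt_ij]; last first.
  by apply: lt_le_trans lt_ij _; rewrite ler_piMl ?time_sq_ge0 // ltW.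
by apply: (shrink (_, _)); apply/allpairsP; exists (i, j); rewrite !mem_enum.
Qed.

Lemma transfers_lightlike_timelike :
  transfers (@spacelike Q d) (@lightlike Q d) (@timelike Q d).
Proof.
move=> v /lightlike_sq_gt0[eq01 gt01].
have [|c c01 shrink] := @same_strict_after_shrinking
    [seq (time_sq (v i) (v j), space_sq (v i) (v j)) |
       i <- enum 'I_4, j <- enum 'I_4].
  by move=> _ /allpairsP[ij [_ _ ->]]; apply: time_sq_ge0.
have c2_lt1 : c ^+ 2 < 1 by nra.
have resc_inj : injective (rescale 1 c : 'rV[Q]_d.+1 -> _).
  by apply: rescale_inj; rewrite ?oner_neq0 // gt_eqF //; lra.
exists (fun i => rescale 1 c (v i)).
  rewrite /timelike time_sq_rescale space_sq_rescale -eq01.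
  by rewrite expr1n mul1r gtr_pMl.
move=> i j; split; first by rewrite (inj_eq resc_inj).
rewrite /spacelike time_sq_rescale space_sq_rescale expr1n mul1r.
apply/idP/idP => [|lt_ij]; last first.
  by apply: lt_le_trans lt_ij _; rewrite ler_piMl ?space_sq_ge0 // ltW.
by apply: (shrink (_, _)); apply/allpairsP; exists (i, j); rewrite !mem_enum.
Qed.

End Dimension.

(** * Null coordinates in a plane *)

Section Plane.
Variable k : nat.

Definition plane_pt (t x : Q) : 'rV[Q]_k.+2 :=
  \row_i (if i == 0 then t else if i == 1 then x else 0).

Lemma time_sq_plane t x t' x' :
  time_sq (plane_pt t x) (plane_pt t' x') = (t - t') ^+ 2.
Proof. by rewrite /time_sq !mxE. Qed.

Lemma space_sq_plane t x t' x' :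
  space_sq (plane_pt t x) (plane_pt t' x') = (x - x') ^+ 2.
Proof.
rewrite /space_sq (bigD1 1) //= !mxE /= big1 ?addr0 // => i /andP[/negbTE i0].
by move=> /negbTE i1; rewrite !mxE i0 i1 subrr expr0n.
Qed.

Lemma plane_pt_inj t x t' x' :
  plane_pt t x = plane_pt t' x' -> t = t' /\ x = x'.
Proof. by move=> /rowP E; move: (E 0) (E 1); rewrite !mxE /=. Qed.

(** This links the grid to the metric: for [t = u + v] and [x = u - v], the difference of the
    squared increments of [t] and [x] is four times the product of the increments of [u] and [v]. *)
Lemma comparable2E (a b : nat * nat) :
  comparable2 a b = (0 < (a.1%:R - b.1%:R) * (a.2%:R - b.2%:R) :> Q).
Proof.
case: a b => a a' [b b'] /=; rewrite /comparable2 /=.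
have lt_nat m n : (m < n)%N -> m%:R < n%:R :> Q by rewrite ltr_nat.
case: (ltngtP a b) (@lt_nat a b) (@lt_nat b a)
   => [_ /(_ isT) ab _|_ _ /(_ isT) ab|->];
  case: (ltngtP a' b') (@lt_nat a' b') (@lt_nat b' a')
     => [_ /(_ isT) ab' _|_ _ /(_ isT) ab'|->] /=; move=> *; apply/esym.
all: rewrite ?subrr ?mulr0 ?mul0r ?ltxx //; do ?[by apply/idP; nra].
all: apply/negbTE; rewrite -leNgt; nra.
Qed.

Lemma transfers_spacelike_lightlike :
  transfers (@timelike Q k.+1) (@spacelike Q k.+1) (@lightlike Q k.+1).
Proof.
apply: (@transfers_plane _ _ _ _
  (fun a => plane_pt (a.1%:R + a.2%:R) (a.1%:R - a.2%:R))).
- exact: timelikeC.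
- by move=> p; rewrite /timelike time_sqxx space_sqxx ltxx.
- move=> p q pq; rewrite /timelike -leNgt ltW // andbT.
  by apply: contraTneq pq => ->; rewrite /spacelike time_sqxx space_sqxx ltxx.
- move=> [a a'] [b b'] /plane_pt_inj[/= ts xs].
  by congr pair; apply/eqP; rewrite -(eqr_nat Q); apply/eqP; lra.
- move=> a b; rewrite comparable2E /timelike time_sq_plane space_sq_plane.
  by apply/idP/idP => h; nra.
(* With equal [v], the increments of [t] and [x] both equal that of [u], which is nonzero. *)
- move=> a b ab1 ab2.
  rewrite /lightlike time_sq_plane space_sq_plane ab2 !mxE /=.
  rewrite (inj_eq (addIr _)) eqr_nat ab1 andbT; apply/eqP; ring.
Qed.

Lemma transfers_timelike_lightlike :
  transfers (@spacelike Q k.+1) (@timelike Q k.+1) (@lightlike Q k.+1).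
Proof.
apply: (@transfers_plane _ _ _ _
  (* Swapping [t] and [x] makes comparability mean [spacelike], while equal [v] still gives
     lightlike pairs. *)
  (fun a => plane_pt (a.1%:R - a.2%:R) (a.1%:R + a.2%:R))).
- exact: spacelikeC.
- by move=> p; rewrite /spacelike time_sqxx space_sqxx ltxx.
- move=> p q pq; rewrite /spacelike -leNgt ltW // andbT.
  by apply: contraTneq pq => ->; rewrite /timelike time_sqxx space_sqxx ltxx.
- move=> [a a'] [b b'] /plane_pt_inj[/= ts xs].
  by congr pair; apply/eqP; rewrite -(eqr_nat Q); apply/eqP; lra.
- move=> a b; rewrite comparable2E /spacelike time_sq_plane space_sq_plane.
  by apply/idP/idP => h; nra.
- move=> a b ab1 ab2.
  rewrite /lightlike time_sq_plane space_sq_plane ab2 !mxE /=.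
  rewrite (inj_eq (addIr _)) eqr_nat ab1 andbT; apply/eqP; ring.
Qed.

End Plane.
End Minkowski.

(* Q^n is 'rV[Q]_n.-1.+1, since 2 <= n. *)
Theorem theorem4p5 (Q : realFieldType) (n : nat) (hn : (2 <= n)%N) :
  let tau := @timelike Q n.-1 in
  let lambda := @lightlike Q n.-1 in
  let sigma := @spacelike Q n.-1 in
  (~ ex2_definable tau sigma /\ ~ all2_definable tau sigma /\
   ~ ex2_definable tau lambda /\ ~ all2_definable tau lambda) /\
  (~ ex2_definable sigma tau /\ ~ all2_definable sigma tau /\
   ~ ex2_definable sigma lambda /\ ~ all2_definable sigma lambda).
Proof.
case: n hn => [|[|k]] //= _.
have lightP p q : @lightlike Q k.+1 p q ->
    ~~ timelike p q /\ ~~ spacelike p q.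
  by case/lightlike_sq_gt0=> E _; rewrite /timelike /spacelike E ltxx.
have light01 : lightlike (plane_pt k 0 0) (plane_pt k (1 : Q) 1).
  by rewrite /lightlike time_sq_plane space_sq_plane !mxE eqxx eq_sym oner_eq0.
have time01 : timelike (plane_pt k 0 0) (plane_pt k (1 : Q) 0).
  by rewrite /timelike time_sq_plane space_sq_plane; nra.
have space01 : spacelike (plane_pt k 0 0) (plane_pt k (0 : Q) 1).
  by rewrite /spacelike time_sq_plane space_sq_plane; nra.
(* Each of the four transfers yields one existential and one universal claim, hence all eight. *)
have [] := transfers_undefinable _ (@transfers_spacelike_lightlike Q k) space01.
  by move=> p q /lightP[].
have [] :=
  transfers_undefinable _ (@transfers_lightlike_spacelike Q k.+1) light01.
  by move=> p q; apply: contraTN => /lightP[].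
have [] := transfers_undefinable _ (@transfers_timelike_lightlike Q k) time01.
  by move=> p q /lightP[].
have [] :=
  transfers_undefinable _ (@transfers_lightlike_timelike Q k.+1) light01.
  by move=> p q; apply: contraTN => /lightP[].
by do !split.
Qed.
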